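(* Let $f:\mathbb{R}^n\times\mathbb{R}^p\to\mathbb{R}$ be continuously differentiable with $L$-Lipschitz gradient, $\mu_x$-strongly convex in $x$ and $\mu_y$-strongly concave in $y$ (in the precise sense given in the context), with $L\ge\mu_x\ge\mu_y>0$, and let $(x^\star,y^\star)$ be its unique saddle point. Let $h,\rho,\alpha$ satisfy $$0<h\le \frac{2}{15L},\qquad \rho=\frac{h\mu_x}{8},\qquad \frac{4}{4+h\sqrt{\mu_x\mu_y}}\le \alpha\le \frac{8}{8+h\sqrt{\mu_x\mu_y}},$$ let $(x_t,y_t,v_t)_{t\ge0}$ be generated by the PCE-DM iteration, and let $\mathcal E_t$ be the associated Lyapunov function (both defined in the context). Then for every $t\ge0$, $$\mathcal E_t\ge \frac{\sqrt{\mu_x\mu_y}}{32}\bigl(\mu_x\lVert x_t-x^\star\rVert^2+\mu_y\lVert y_t-y^\star\rVert^2\bigr)\ge0.$$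
   Context: Norms and inner products are Euclidean. Assumptions on $f$: (i) $\lVert\nabla f(x',y')-\nabla f(x,y)\rVert\le L\lVert(x'-x,y'-y)\rVert$ for all $(x,y),(x',y')\in\mathbb{R}^n\times\mathbb{R}^p$, where $\nabla f=(\nabla_x f,\nabla_y f)$ is the full gradient; (ii) for all $x,x'\in\mathbb{R}^n$ and $y,y'\in\mathbb{R}^p$, $$f(x',y)\ge f(x,y)+\langle\nabla_x f(x,y),x'-x\rangle+\tfrac{\mu_x}{2}\lVert x'-x\rVert^2,$$ $$f(x,y')\le f(x,y)+\langle\nabla_y f(x,y),y'-y\rangle-\tfrac{\mu_y}{2}\lVert y'-y\rVert^2.$$ Under these assumptions $f$ has a unique saddle point $(x^\star,y^\star)$ (for $\min_x\max_y f$), $\nabla f(x^\star,y^\star)=0$, and we write $f^\star=f(x^\star,y^\star)$. PCE-DM iteration with parameters $h,\alpha,\rho$: given an arbitrary $(x_0,y_0)\in\mathbb{R}^n\times\mathbb{R}^p$ and $v_0=0$, for $t=0,1,2,\dots$ set $$\widetilde x_t=x_t-h\nabla_x f(x_t,y_t),\qquad \widetilde y_t=y_t+h\bigl(\nabla_y f(x_t,y_t)+v_t\bigr),$$ $$\widetilde v_t=\alpha v_t+\rho\nabla_y f(\widetilde x_t,\widetilde y_t),$$ $$x_{t+1}=x_t-h\nabla_x f(\widetilde x_t,\widetilde y_t),\qquad y_{t+1}=y_t+h\bigl(\nabla_y f(\widetilde x_t,\widetilde y_t)+\widetilde v_t\bigr),$$ $$v_{t+1}=\alpha v_t+\rho\nabla_y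 f(x_{t+1},y_{t+1}).$$ Directions: $d_t^x:=\nabla_x f(x_t,y_t)$ and $d_t^y:=\nabla_y f(x_t,y_t)+v_t$. Lyapunov function: $$\mathcal E_t:=-\frac{1-\alpha+2\rho}{2\alpha h}\bigl(f(x_t,y_t)-f^\star\bigr)+\frac12\lVert d_t^x\rVert^2+\frac12\lVert d_t^y\rVert^2+\frac{1-\alpha}{2\alpha h}\langle v_t,y_t-y^\star\rangle+\frac{(1-\alpha)^2}{4\alpha^2h^2}\lVert y_t-y^\star\rVert^2.$$ *)

(* Defs.v *)
From HB Require Import structures.
From mathcomp Require Import all_boot all_order all_algebra.
From mathcomp Require Import all_classical all_reals all_analysis.

Set Implicit Arguments.
Unset Strict Implicit.
Unset Printing Implicit Defensive.

Import Order.TTheory GRing.Theory Num.Theory.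
Import numFieldNormedType.Exports.

Local Open Scope classical_set_scope.
Local Open Scope ring_scope.

(* R^n is 'rV[R]_n. The library norm `|x| on 'rV[R]_n is the sup norm (and the
   norm on a product is a max); it is used here only for the topology, that is
   for differentiability and continuity. All quantitative statements use the
   Euclidean inner product and norms below. *)
Definition dot (R : realType) (n : nat) (u v : 'rV[R]_n) : R :=
  \sum_(i < n) u 0 i * v 0 i.

Definition enorm (R : realType) (n : nat) (u : 'rV[R]_n) : R :=
  Num.sqrt (dot u u).

Definition enorm2 (R : realType) (n p : nat) (z : 'rV[R]_n * 'rV[R]_p) : R :=
  Num.sqrt (enorm z.1 ^+ 2 + enorm z.2 ^+ 2).

Definition grad (R : realType) (n : nat) (g : 'rV[R]_n -> R) (x : 'rV[R]_n) :
    'rV[R]_n :=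
  \row_(i < n) 'D_('e_i) g x.

Definition gradx (R : realType) (n p : nat) (f : 'rV[R]_n * 'rV[R]_p -> R)
    (x : 'rV[R]_n) (y : 'rV[R]_p) : 'rV[R]_n :=
  grad (fun x' => f (x', y)) x.

Definition grady (R : realType) (n p : nat) (f : 'rV[R]_n * 'rV[R]_p -> R)
    (x : 'rV[R]_n) (y : 'rV[R]_p) : 'rV[R]_p :=
  grad (fun y' => f (x, y')) y.

Definition full_grad (R : realType) (n p : nat) (f : 'rV[R]_n * 'rV[R]_p -> R)
    (z : 'rV[R]_n * 'rV[R]_p) : 'rV[R]_n * 'rV[R]_p :=
  (gradx f z.1 z.2, grady f z.1 z.2).

Definition continuously_differentiable (R : realType) (n p : nat)
    (f : 'rV[R]_n * 'rV[R]_p -> R) : Prop :=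
  (forall z, differentiable f z) /\ continuous (full_grad f).

Definition lipschitz_gradient (R : realType) (n p : nat)
    (f : 'rV[R]_n * 'rV[R]_p -> R) (L : R) : Prop :=
  forall z z' : 'rV[R]_n * 'rV[R]_p,
    enorm2 (full_grad f z' - full_grad f z) <= L * enorm2 (z' - z).

Definition strongly_convex_x (R : realType) (n p : nat)
    (f : 'rV[R]_n * 'rV[R]_p -> R) (mu : R) : Prop :=
  forall (x x' : 'rV[R]_n) (y : 'rV[R]_p),
    f (x', y) >= f (x, y) + dot (gradx f x y) (x' - x)
                 + mu / 2 * enorm (x' - x) ^+ 2.

Definition strongly_concave_y (R : realType) (n p : nat)
    (f : 'rV[R]_n * 'rV[R]_p -> R) (mu : R) : Prop :=
  forall (x : 'rV[R]_n) (y y' : 'rV[R]_p),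
    f (x, y') <= f (x, y) + dot (grady f x y) (y' - y)
                 - mu / 2 * enorm (y' - y) ^+ 2.

Definition saddle_point (R : realType) (n p : nat)
    (f : 'rV[R]_n * 'rV[R]_p -> R) (xs : 'rV[R]_n) (ys : 'rV[R]_p) : Prop :=
  forall (x : 'rV[R]_n) (y : 'rV[R]_p),
    f (xs, y) <= f (xs, ys) <= f (x, ys).

Definition pce_dm (R : realType) (n p : nat) (f : 'rV[R]_n * 'rV[R]_p -> R)
    (h alpha rho : R) (x : nat -> 'rV[R]_n) (y v : nat -> 'rV[R]_p) : Prop :=
  v 0%N = 0 /\
  forall t : nat,
    let xt := x t - h *: gradx f (x t) (y t) in
    let yt := y t + h *: (grady f (x t) (y t) + v t) in
    let vt := alpha *: v t + rho *: grady f xt yt in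
    [/\ x t.+1 = x t - h *: gradx f xt yt,
        y t.+1 = y t + h *: (grady f xt yt + vt) &
        v t.+1 = alpha *: v t + rho *: grady f (x t.+1) (y t.+1)].

Definition dirx (R : realType) (n p : nat) (f : 'rV[R]_n * 'rV[R]_p -> R)
    (x : nat -> 'rV[R]_n) (y : nat -> 'rV[R]_p) (t : nat) : 'rV[R]_n :=
  gradx f (x t) (y t).

Definition diry (R : realType) (n p : nat) (f : 'rV[R]_n * 'rV[R]_p -> R)
    (x : nat -> 'rV[R]_n) (y v : nat -> 'rV[R]_p) (t : nat) : 'rV[R]_p :=
  grady f (x t) (y t) + v t.

Definition lyapunov (R : realType) (n p : nat) (f : 'rV[R]_n * 'rV[R]_p -> R)
    (h alpha rho : R) (xs : 'rV[R]_n) (ys : 'rV[R]_p)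
    (x : nat -> 'rV[R]_n) (y v : nat -> 'rV[R]_p) (t : nat) : R :=
  - ((1 - alpha + 2 * rho) / (2 * alpha * h)) * (f (x t, y t) - f (xs, ys))
  + 1 / 2 * enorm (dirx f x y t) ^+ 2
  + 1 / 2 * enorm (diry f x y v t) ^+ 2
  + (1 - alpha) / (2 * alpha * h) * dot (v t) (y t - ys)
  + (1 - alpha) ^+ 2 / (4 * alpha ^+ 2 * h ^+ 2) * enorm (y t - ys) ^+ 2.

(* Main.v *)
Require Import Defs.
From HB Require Import structures.
From mathcomp Require Import all_boot all_order all_algebra.
From mathcomp Require Import all_classical all_reals all_analysis.
From mathcomp Require Import ring lra.

Import Order.TTheory GRing.Theory Num.Theory.
Import numFieldNormedType.Exports.

Local Open Scope ring_scope.

(** The bound is proved separately for each t, without induction.  Write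
    a = (1 - alpha) / (alpha h) and b = rho / (alpha h), so that
    sqrt (mux muy) / 8 <= a <= sqrt (mux muy) / 4 and a + b <= mux; let
    fs = f(xs, ys).  Completing the square in d^y + (a / 2) (y - ys) eliminates v
    and leaves the term - (a / 2) <grad_y f(x, y), y - ys>, which strong concavity
    bounds below by (a / 2) (f(x, ys) - f(x, y)) + (a muy / 4) |y - ys|^2;
    here f(x, ys) >= fs + (mux / 2) |x - xs|^2.  What remains is - (a + b) (f - fs),
    and it is absorbed by |d^x|^2 / 2 through the Polyak-Lojasiewicz inequality
    |d^x|^2 / 2 >= mux (f(x, y) - f(xs, y)) >= mux (f(x, y) - fs). *)

Section Dot.
Context {R : realType} {n : nat}.
Implicit Types (u v w : 'rV[R]_n) (c : R).

Lemma dotC u v : dot u v = dot v u.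
Proof. by apply: eq_bigr => i _; rewrite mulrC. Qed.

Lemma dotDl u v w : dot (u + v) w = dot u w + dot v w.
Proof. by rewrite -big_split; apply: eq_bigr => i _; rewrite mxE mulrDl. Qed.

Lemma dotZl c u v : dot (c *: u) v = c * dot u v.
Proof. by rewrite /dot mulr_sumr; apply: eq_bigr => i _; rewrite mxE mulrA. Qed.

Lemma dotNl u v : dot (- u) v = - dot u v.
Proof. by rewrite -scaleN1r dotZl mulN1r. Qed.

Lemma dotDr u v w : dot w (u + v) = dot w u + dot w v.
Proof. by rewrite dotC dotDl !(dotC w). Qed.

Lemma dotZr c u v : dot v (c *: u) = c * dot v u.
Proof. by rewrite dotC dotZl dotC. Qed.

Lemma dotNr u v : dot v (- u) = - dot v u.
Proof. by rewrite dotC dotNl dotC. Qed.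

Definition dotE := (dotDl, dotDr, dotNl, dotNr, dotZl, dotZr).

Lemma dot_ge0 u : 0 <= dot u u.
Proof. by apply: sumr_ge0 => i _; rewrite -expr2 sqr_ge0. Qed.

Lemma dot_eq0 u : dot u u = 0 -> u = 0.
Proof.
move=> /eqP; rewrite psumr_eq0 => [/allP u0|i _]; last by rewrite -expr2 sqr_ge0.
apply/rowP => i; rewrite mxE; apply/eqP; rewrite -sqrf_eq0 expr2.
exact: u0 (mem_index_enum i).
Qed.

Lemma dot0l u : dot 0 u = 0.
Proof. by rewrite -(scale0r u) dotZl mul0r. Qed.

Lemma sqr_enorm u : enorm u ^+ 2 = dot u u.
Proof. by rewrite sqr_sqrtr ?dot_ge0. Qed.

End Dot.

Section StronglyConvexConcave.
Context {R : realType} {n p : nat} {f : 'rV[R]_n * 'rV[R]_p -> R}.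

Lemma sqr_enorm2 (z : 'rV[R]_n * 'rV[R]_p) :
  enorm2 z ^+ 2 = dot z.1 z.1 + dot z.2 z.2.
Proof. by rewrite sqr_sqrtr ?addr_ge0 ?sqr_ge0// !sqr_enorm. Qed.

Lemma lipschitz_gradx {L : R} (f_lip : lipschitz_gradient f L)
    (x x' : 'rV[R]_n) (y : 'rV[R]_p) :
  dot (gradx f x' y - gradx f x y) (gradx f x' y - gradx f x y)
    <= L ^+ 2 * dot (x' - x) (x' - x).
Proof.
have lip := f_lip (x, y) (x', y).
have : enorm2 (full_grad f (x', y) - full_grad f (x, y)) ^+ 2
    <= (L * enorm2 ((x', y) - (x, y))) ^+ 2.
  by rewrite lerXn2r// nnegrE ?(le_trans _ lip)// sqrtr_ge0.
(* The two points share [y], so only the x part survives on the right; on the left the nonnegative y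
   part is dropped. *)
rewrite exprMn !sqr_enorm2 /= subrr dot0l addr0; apply: le_trans.
by rewrite lerDl dot_ge0.
Qed.

(* A gradient step x' = x - g / (2 L) from a minimiser x gives <g', g> <= 0 by
   convexity, while |g' - g| <= |g| / 2. *)
Lemma gradx_min_eq0 {L mu : R} {x : 'rV[R]_n} {y : 'rV[R]_p} :
    0 < L -> 0 <= mu -> lipschitz_gradient f L -> strongly_convex_x f mu ->
  (forall x', f (x, y) <= f (x', y)) -> gradx f x y = 0.
Proof.
move=> L_gt0 mu_ge0 f_lip f_cvx x_min; apply: dot_eq0.
set g := gradx f x y; set e := (2 * L)^-1.
have e_gt0 : 0 < e by rewrite invr_gt0 mulr_gt0.
have Le : L * e = 1 / 2 by rewrite /e; field; rewrite gt_eqF.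
pose x' := x - e *: g; pose g' := gradx f x' y.
have step : x - x' = e *: g by rewrite opprB addrCA subrr addr0.
have g'g_le0 : dot g' g <= 0.
  have := f_cvx x' x y; rewrite step sqr_enorm dotZr -/g' => cvx.
  have := x_min x'; have := mulr_ge0 mu_ge0 (dot_ge0 (e *: g)) => ? ?.
  have : e * dot g' g <= 0 by lra.
  by rewrite pmulr_rle0.
have := lipschitz_gradx f_lip x x' y; rewrite -/g' -/g -(opprB x x') step.
rewrite !dotE (dotC g g') => lip.
(* Since [L * e = 1 / 2], the bound becomes |g' - g|^2 <= |g|^2 / 4. Expanding it with <g', g> <= 0
   gives |g'|^2 + (3/4) |g|^2 <= 0. *)
have lip4 : L ^+ 2 * (- - (e * (e * dot g g))) = (1 / 4) * dot g g.
  by rewrite opprK; transitivity ((L * e) ^+ 2 * dot g g); [ring | rewrite Le; field].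
have := dot_ge0 g; have := dot_ge0 g'; lra.
Qed.

(** The gradient vanishes at the minimiser, which kills the linear term of strong convexity. *)
Lemma strongly_convex_quadratic_growth {L mu : R} {x : 'rV[R]_n} {y : 'rV[R]_p}
    (x' : 'rV[R]_n) :
    0 < L -> 0 <= mu -> lipschitz_gradient f L -> strongly_convex_x f mu ->
    (forall x'', f (x, y) <= f (x'', y)) ->
  f (x, y) + mu / 2 * dot (x' - x) (x' - x) <= f (x', y).
Proof.
move=> L_gt0 mu_ge0 f_lip f_cvx x_min.
have := f_cvx x x' y.
by rewrite (gradx_min_eq0 L_gt0 mu_ge0 f_lip f_cvx x_min) dot0l addr0 sqr_enorm.
Qed.

Lemma polyak_lojasiewicz_x {mu : R} (x x' : 'rV[R]_n) (y : 'rV[R]_p) :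
    0 < mu -> strongly_convex_x f mu ->
  mu * (f (x, y) - f (x', y)) <= 1 / 2 * dot (gradx f x y) (gradx f x y).
Proof.
move=> mu_gt0 f_cvx; have := f_cvx x x' y; rewrite sqr_enorm.
move: (gradx f x y) (x' - x) => g d.
rewrite -(ler_pM2l mu_gt0) => cvx.
(* After scaling by [mu], the gap is at most - mu <g, d> - (mu^2 / 2) |d|^2, which equals (|g|^2 -
   |g + mu d|^2) / 2. *)
have := dot_ge0 (g + mu *: d); rewrite !dotE (dotC d g); nra.
Qed.

End StronglyConvexConcave.

Lemma sqrt_mulr_le {R : rcfType} (a b : R) :
  0 <= b -> b <= a -> Num.sqrt (a * b) <= a.
Proof.
move=> b_ge0 ba; have a_ge0 := le_trans b_ge0 ba.
by rewrite -[leRHS]ger0_norm// -sqrtr_sqr ler_wsqrtr// expr2 ler_wpM2l.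
Qed.

Theorem lemma3p3 (R : realType) (n p : nat) (f : 'rV[R]_n * 'rV[R]_p -> R)
    (L mux muy h alpha rho : R)
    (xs : 'rV[R]_n) (ys : 'rV[R]_p)
    (x : nat -> 'rV[R]_n) (y v : nat -> 'rV[R]_p)
    (f_C1 : continuously_differentiable f)
    (f_lip : lipschitz_gradient f L)
    (f_cvx : strongly_convex_x f mux)
    (f_ccv : strongly_concave_y f muy)
    (L_ge_mux : mux <= L) (mux_ge_muy : muy <= mux) (muy_gt0 : 0 < muy)
    (saddle : saddle_point f xs ys)
    (h_gt0 : 0 < h) (h_le : h <= 2 / (15 * L))
    (rhoE : rho = h * mux / 8)
    (alpha_ge : 4 / (4 + h * Num.sqrt (mux * muy)) <= alpha)
    (alpha_le : alpha <= 8 / (8 + h * Num.sqrt (mux * muy)))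
    (iteration : pce_dm f h alpha rho x y v) :
  forall t : nat,
    lyapunov f h alpha rho xs ys x y v t >=
      Num.sqrt (mux * muy) / 32 *
        (mux * enorm (x t - xs) ^+ 2 + muy * enorm (y t - ys) ^+ 2) /\
    Num.sqrt (mux * muy) / 32 *
      (mux * enorm (x t - xs) ^+ 2 + muy * enorm (y t - ys) ^+ 2) >= 0.
Proof.
move=> t.
have mux_gt0 : 0 < mux := lt_le_trans muy_gt0 mux_ge_muy.
have L_gt0 : 0 < L := lt_le_trans mux_gt0 L_ge_mux.
set s := Num.sqrt (mux * muy).
have s_gt0 : 0 < s by rewrite sqrtr_gt0 mulr_gt0.
have s_le : s <= mux by apply: sqrt_mulr_le; rewrite // ltW.
have hs_le : h * s <= 2 / 15.
  have : h * (15 * L) <= 2 by rewrite -ler_pdivlMr// mulr_gt0.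
  nra.
have hs_gt0 : 0 < h * s by rewrite mulr_gt0.
have alpha_gt0 : 0 < alpha by apply: lt_le_trans alpha_ge; rewrite divr_gt0 ?addr_gt0.
pose a := (1 - alpha) / (alpha * h); pose b := rho / (alpha * h).
have [alpha_neq0 h_neq0] : alpha != 0 /\ h != 0 by rewrite !gt_eqF.
have ahP : a * (alpha * h) = 1 - alpha by rewrite /a; field; rewrite ?alpha_neq0 ?h_neq0.
have bP : b * alpha = mux / 8 by rewrite /b rhoE; field; rewrite ?alpha_neq0 ?h_neq0.
have ah_gt0 : 0 < alpha * h by rewrite mulr_gt0.
have alpha_lb : 4 <= alpha * (4 + h * s) by rewrite -ler_pdivrMr ?addr_gt0.
have alpha_ub : alpha * (8 + h * s) <= 8 by rewrite -ler_pdivlMr ?addr_gt0.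
(* Multiplied by [alpha * h], the upper bound on [alpha] becomes the lower bound on [a], and
   conversely. *)
have a_ge : s / 8 <= a by rewrite -(ler_pM2r ah_gt0) ahP; lra.
have a_le : a <= s / 4 by rewrite -(ler_pM2r ah_gt0) ahP; lra.
have ab_le : a + b <= mux.
  (* A crude bound suffices: [h * s <= 2 / 15] already gives [alpha] >= 30/31. Then [a] and [b] are
     each at most [mux / 4]. *)
  have alpha_ge_half : 1 / 2 <= alpha by nra.
  have : b <= mux / 4 by rewrite -(ler_pM2r alpha_gt0) bP; nra.
  lra.
have b_ge0 : 0 <= b by rewrite divr_ge0 ?ltW// rhoE; nra.
rewrite /lyapunov /dirx /diry !sqr_enorm.
set X := x t - xs; set Y := y t - ys.
set u := gradx f _ _; set g := grady f _ _.
have X_ge0 := dot_ge0 X; have Y_ge0 := dot_ge0 Y.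
split; last by rewrite mulr_ge0 ?addr_ge0 ?mulr_ge0 ?divr_ge0// ltW.
have -> : (1 - alpha + 2 * rho) / (2 * alpha * h) = a / 2 + b.
  by rewrite /a /b; field; rewrite ?alpha_neq0 ?h_neq0.
have -> : (1 - alpha) / (2 * alpha * h) = a / 2.
  by rewrite /a; field; rewrite ?alpha_neq0 ?h_neq0.
have -> : (1 - alpha) ^+ 2 / (4 * alpha ^+ 2 * h ^+ 2) = a ^+ 2 / 4.
  by rewrite /a; field; rewrite ?alpha_neq0 ?h_neq0.
have a_ge0 : 0 <= a by lra.
have growth : f (xs, ys) + mux / 2 * dot X X <= f (x t, ys).
  apply: (strongly_convex_quadratic_growth (L := L)) => //; first exact: ltW.
  by move=> x'; have /andP[] := saddle x' ys.
have concave : f (x t, ys) <= f (x t, y t) - dot g Y - muy / 2 * dot Y Y.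
  have := f_ccv (x t) (y t) ys.
  by rewrite sqr_enorm -(opprB (y t) ys) -/Y dotNl !dotNr opprK.
have absorb : (a + b) * (f (x t, y t) - f (xs, ys)) <= 1 / 2 * dot u u.
  have pl := polyak_lojasiewicz_x (x t) xs (y t) mux_gt0 f_cvx.
  have /andP[fs_le _] := saddle xs (y t).
  have u_ge0 := dot_ge0 u; rewrite -/u in pl.
  (* The gap f(x, y) - fs has no fixed sign: if nonnegative, [a + b <= mux] and [pl] apply; if
     negative, the left side is at most 0. *)
  have [D_ge0|D_lt0] := leP 0 (f (x t, y t) - f (xs, ys)); nra.
have Q_ge0 : 0 <= mux * dot X X + muy * dot Y Y.
  by rewrite addr_ge0 ?mulr_ge0// ltW.
(* Half of [slack] contributes a / 4 times the quadratic form in [Q_ge0], and [a >= s / 8] turns a /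
   4 into the claimed [s / 32]. *)
have coef := ler_wpM2r Q_ge0 a_ge.
have slack := ler_wpM2l a_ge0 (le_trans growth concave).
have a2_ge0 := mulr_ge0 (sqr_ge0 a) Y_ge0.
(* Half of this square uses a^2 / 8 of the available coefficient a^2 / 4 of |Y|^2; the rest is
   nonnegative by [a2_ge0] and is discarded. *)
have := dot_ge0 (g + v t + (a / 2) *: Y); clearbody X Y u g.
rewrite !dotE (dotC Y g) (dotC Y (v t)) (dotC (v t) g) => square.
lra.
Qed.
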